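(* Let $H=\{(K,x)\in\mathcal{K}(\mathbb{Z}^\omega)\times\mathbb{Z}^\omega : x\in K\}$. There exists a map $t:\mathcal{K}(\mathbb{Z}^\omega)\to\mathbb{Z}^\omega$ such that the map $T:H\to\mathbb{Z}^\omega$ defined by $T(K,x)=x+t(K)$ is a homeomorphism between $H$ and the set \[F=T(H)=\bigcup_{K\in\mathcal{K}(\mathbb{Z}^\omega)}(K+t(K)),\] where this union is disjoint. Moreover, $F$ is a closed subset of $\mathbb{Z}^\omega$ and satisfies \[(K+t(K)+\{-1,0,1\}^\omega)\cap F=K+t(K)\] for each $K\in\mathcal{K}(\mathbb{Z}^\omega)$.
   Context: $\mathbb{Z}^\omega$ is the group of integer sequences under coordinatewise addition, with the product topology of discrete copies of $\mathbb{Z}$. $\mathcal{K}(\mathbb{Z}^\omega)$ denotes the space of nonempty compact subsets of $\mathbb{Z}^\omega$ with the Vietoris topology, and $H$ carries the subspace topology of the product $\mathcal{K}(\mathbb{Z}^\omega)\times\mathbb{Z}^\omega$. $\{-1,0,1\}^\omega$ is viewed as a subset of $\mathbb{Z}^\omega$, and sums of sets are Minkowski sums. *)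

(* Defs.v *)
From HB Require Import structures.
From mathcomp Require Import all_boot all_order all_algebra.
From mathcomp Require Import all_classical all_reals all_analysis.

Set Implicit Arguments.
Unset Strict Implicit.
Unset Printing Implicit Defensive.

Import GRing.Theory.
Local Open Scope classical_set_scope.
Local Open Scope ring_scope.

(* [int] carries no canonical topology in the library, hence the explicit
   [discrete_topology]. *)
Definition Zomega : Type := prod_topology (fun _ : nat => discrete_topology int).

HB.instance Definition _ := Topological.on Zomega.
HB.instance Definition _ := GRing.Zmodule.copy Zomega (nat -> int).

Definition hyperspace (X : topologicalType) : Type :=
  set_type [set K : set X | K !=set0 /\ compact K].

Definition hset (X : topologicalType) (K : hyperspace X) : set X := set_val K.

(* Subbase of the Vietoris topology, for U open:
   (true, U) is the set of K contained in U, and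
   (false, U) is the set of K that meet U. *)
Definition vietoris_subbase (X : topologicalType) (i : bool * set X) :
    set (hyperspace X) :=
  if i.1 then [set K | hset K `<=` i.2] else [set K | hset K `&` i.2 !=set0].

HB.instance Definition _ (X : topologicalType) := Choice.on (hyperspace X).
HB.instance Definition _ (X : topologicalType) :=
  isSubBaseTopological.Build (hyperspace X)
    [set i : bool * set X | open i.2] (@vietoris_subbase X).

(* Both [A] and [B] carry the subspace topology; [f] and the inverse [g] are
   total functions of which only the restrictions to [A] and [B] matter. *)
Definition homeomorphism_between (X Y : topologicalType)
    (A : set X) (B : set Y) (f : X -> Y) : Prop :=
  [/\ set_bij A B f,
      {within A, continuous f} &
      exists2 g : Y -> X, {in A, cancel f g} & {within B, continuous g}].

Definition translate (V : zmodType) (A : set V) (v : V) : set V :=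
  [set a + v | a in A].

Definition minkowski_sum (V : zmodType) (A B : set V) : set V :=
  [set a + b | a in A & b in B].

Definition sign_sequences : set Zomega :=
  [set e | forall n, [\/ e n = -1 :> int, e n = 0 :> int | e n = 1 :> int]].

Definition hyperspace_graph (X : topologicalType) : set (hyperspace X * X) :=
  [set p | hset p.1 p.2].

(* Main.v *)
(* Enumerate the finite sets of integer words of length n + 1 and let t(K)(n)
   be a code of the set of restrictions to {0, ..., n} of the points of K. The
   codes are spread so far apart that the n-th coordinate of x + t(K), for x in
   K, reveals this finite set, even after an error of at most 1. So a point of F
   determines K, and its first n coordinates determine K and x up to level n;
   since these finite approximations form neighborhood bases in the Vietoris
   topology, T is a homeomorphism. F is closed because a coherent sequence of
   finite approximations is realized by a compact set. *)
From HB Require Import structures.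
Require Import Defs.
From mathcomp Require Import all_boot all_order all_algebra zify.
From mathcomp Require Import finmap.
From mathcomp Require Import all_classical all_reals all_analysis.

Set Implicit Arguments.
Unset Strict Implicit.
Unset Printing Implicit Defensive.
Import Order.TTheory GRing.Theory Num.Theory.
Local Open Scope classical_set_scope.
Local Open Scope ring_scope.

(** * Integer codes with widely separated intervals *)

Lemma separated_centers (A : countType) (M : A -> nat) :
  exists c : A -> int, forall a b (u v : int),
    `|u| <= (M a)%:Z -> `|v| <= (M b)%:Z ->
    `|(u + c a) - (v + c b)| <= 1 -> a = b.
Proof.
(* The centers are 2 w(a)^2 with w injective and M < w: consecutive squares
   leave room for intervals of radius w. *)
pose w a := ((choice.pickle a).*2.+1 * 2 ^ M a)%N.
have wM a : (M a < w a)%N.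
  by apply: (leq_trans (ltn_expl (M a) (ltnSn 1))); rewrite leq_pmull.
(* The other factor of [w a] is odd, so the exponent of 2 recovers [M a]; cancelling the power of 2
   then recovers the code of [a]. *)
have w_inj a b : w a = w b -> a = b.
  move=> wab; have := congr1 (logn 2) wab; rewrite /w.
  rewrite !lognM ?expn_gt0// !pfactorK// !logn_coprime ?add0n; last 2 first.
  - by rewrite coprime2n /= odd_double.
  - by rewrite coprime2n /= odd_double.
  move=> Mab; move: wab; rewrite /w Mab => /eqP; rewrite eqn_pmul2r ?expn_gt0//.
  by rewrite eqSS => /eqP/double_inj/(pcan_inj choice.pickleK).
have gap a b (u v : int) : (w a < w b)%N ->
    `|u| <= (M a)%:Z -> `|v| <= (M b)%:Z ->
    `|(u + (2 * w a ^ 2)%N%:Z) - (v + (2 * w b ^ 2)%N%:Z)| <= 1 -> False.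
  by have := wM a; have := wM b; nia.
exists (fun a => (2 * w a ^ 2)%N%:Z) => a b u v ua vb uvab.
have [wab|wab|/w_inj//] := ltngtP (w a) (w b).
  by have := gap _ _ _ _ wab ua vb uvab.
by have := gap _ _ _ _ wab vb ua; rewrite distrC => /(_ uvab).
Qed.

(** * Prefixes and cylinders *)

Definition prefix (n : nat) (x : Zomega) : seq int := mkseq x n.

Lemma prefixP n (x y : Zomega) :
  prefix n x = prefix n y <-> forall i, (i < n)%N -> x i = y i.
Proof.
split=> [xy i ltin|xy]; last by apply/eq_in_map => i; rewrite mem_iota => /xy.
by have := congr1 (fun s => nth 0 s i) xy; rewrite !nth_mkseq.
Qed.

Lemma prefix_le m n (x y : Zomega) :
  (m <= n)%N -> prefix n x = prefix n y -> prefix m x = prefix m y.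
Proof.
by move=> mn /prefixP xy; apply/prefixP => i im; apply/xy/(leq_trans im).
Qed.

Definition cylinder (n : nat) (x : Zomega) : set Zomega :=
  [set y | prefix n y = prefix n x].

Lemma nbhs_coord (n : nat) (x : Zomega) : nbhs x [set y : Zomega | y n = x n].
Proof.
exact: (@proj_continuous nat (fun=> discrete_topology int) n x
  _ (discrete_set1 (x n))).
Qed.

Lemma nbhs_cylinder (n : nat) (x : Zomega) : nbhs x (cylinder n x).
Proof.
elim: n => [|n IHn]; first by apply: filterS filterT => y _; apply/prefixP.
apply: filterS (filterI IHn (nbhs_coord n x)) => y [/prefixP yx yxn].
by apply/prefixP => i; rewrite ltnS leq_eqVlt => /predU1P[->//|/yx].
Qed.

Lemma open_cylinder (n : nat) (x : Zomega) : open (cylinder n x).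
Proof.
rewrite openE => y yx; apply: filterS (nbhs_cylinder n y) => z zy.
by rewrite /cylinder/= zy.
Qed.

(** The product topology is the supremum of the topologies induced by the coordinates, so the filter
    generated by the cylinders need only converge for each of these; the cylinder of length [i.+1]
    fixes coordinate [i]. *)
Lemma nbhs_cylinderP (x : Zomega) (U : set Zomega) :
  nbhs x U <-> exists n, cylinder n x `<=` U.
Proof.
split=> [|[n /filterS]]; last by apply; exact: nbhs_cylinder.
have FF : Filter (filter_from setT (cylinder^~ x)).
  apply: filter_from_filter; first by exists 0%N.
  move=> m n _ _; exists (maxn m n) => // y yx.
  by split; apply: prefix_le yx; rewrite ?leq_maxl ?leq_maxr.
have : filter_from setT (cylinder^~ x) --> x.
  apply/cvg_sup => i V [W [[B oB <-] Bx BV]].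
  exists i.+1 => // y /prefixP yx; apply: BV => /=.
  by rewrite yx.
by move=> /(_ U) xU /xU[n _ nU]; exists n.
Qed.

(** * Compact sets and their finite traces *)

Lemma hset_compact (X : topologicalType) (K : hyperspace X) :
  compact (hset K).
Proof. by have /set_mem[] := valP K. Qed.

Lemma hset_neq0 (X : topologicalType) (K : hyperspace X) : hset K !=set0.
Proof. by have /set_mem[] := valP K. Qed.

Lemma hyperspace_of (X : topologicalType) (A : set X) :
  A !=set0 -> compact A -> exists K : hyperspace X, hset K = A.
Proof.
move=> A0 cA.
have AP : A \in [set K : set X | K !=set0 /\ compact K] by apply/mem_set.
by exists (SigSub AP).
Qed.

Lemma hausdorff_Zomega : hausdorff_space Zomega.
Proof.
apply: (@hausdorff_product nat (fun=> discrete_topology int)) => _.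
exact: discrete_hausdorff.
Qed.

Lemma hset_closed (K : hyperspace Zomega) : closed (hset K).
Proof.
by apply: compact_closed; [exact: hausdorff_Zomega|exact: hset_compact].
Qed.

(* [compact_cover] is stated for pointed spaces only. *)
HB.instance Definition _ := isPointed.Build Zomega 0.

(** Constant [m] yields finiteness of the traces; lengths varying with the point serve to fit the
    cylinders inside a given open set. *)
Lemma compact_cylinder_cover (K : set Zomega) (m : Zomega -> nat) :
  compact K -> finite_subset_cover K (fun x => cylinder (m x) x) K.
Proof.
rewrite compact_cover; apply=> [x _|x Kx]; first exact: open_cylinder.
by exists x.
Qed.

Lemma finite_prefixes (n : nat) (K : set Zomega) :
  compact K -> finite_set (prefix n @` K).
Proof.
move=> /(compact_cylinder_cover (fun=> n))[D DK KD].
apply: (@sub_finite_set _ _ (prefix n @` [set` D])).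
  by move=> _ [x /KD[y yD xy] <-]; exists y.
exact/finite_image/finite_fset.
Qed.

(** [fset_set] is faithful only on finite sets, which [finite_prefixes] ensures here. The type
    [{fset seq int}] is countable, so traces can be coded by integers. *)
Definition trace (n : nat) (K : hyperspace Zomega) : {fset seq int} :=
  fset_set (prefix n @` hset K).

Lemma traceP (n : nat) (K : hyperspace Zomega) (s : seq int) :
  s \in trace n K <-> (prefix n @` hset K) s.
Proof.
have fK := finite_prefixes n (hset_compact (K := K)).
by rewrite /trace in_fset_set//; split=> [/set_mem|/mem_set].
Qed.

Lemma mem_trace (n : nat) (K : hyperspace Zomega) (x : Zomega) :
  hset K x -> prefix n x \in trace n K.
Proof. by move=> Kx; apply/traceP; exists x. Qed.

Lemma trace_le (m n : nat) (K L : hyperspace Zomega) :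
  (m <= n)%N -> trace n K = trace n L -> trace m K = trace m L.
Proof.
move=> mn KL; have sub (A B : hyperspace Zomega) :
    trace n A = trace n B -> {subset trace m A <= trace m B}.
  move=> AB s /traceP[x Ax <-]; apply/traceP.
  have := mem_trace n Ax; rewrite AB => /traceP[y By yx].
  by exists y => //; exact: prefix_le yx.
by apply/fsetP => s; apply/idP/idP; exact: sub.
Qed.

Lemma trace_prefix_le (m n : nat) (K : hyperspace Zomega) (x : Zomega) :
  (m <= n)%N -> prefix n x \in trace n K -> prefix m x \in trace m K.
Proof.
move=> mn /traceP[y Ky yx]; apply/traceP; exists y => //.
exact: prefix_le yx.
Qed.

(** A compact set in a Hausdorff space is closed, and the hypothesis puts a point of it in every
    cylinder around [x]. *)
Lemma mem_hset (K : hyperspace Zomega) (x : Zomega) :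
  (forall n, prefix n x \in trace n K) -> hset K x.
Proof.
move=> xK; rewrite ((closure_id _).1 (@hset_closed K)) => U.
move=> /nbhs_cylinderP[n xU]; have /traceP[y Ky yx] := xK n.
by exists y; split=> //; exact: xU.
Qed.

Lemma trace_inj (K L : hyperspace Zomega) :
  (forall n, trace n K = trace n L) -> K = L.
Proof.
move=> KL; apply: val_inj; apply/seteqP; split=> x Kx; apply: mem_hset => n.
  by rewrite -KL; exact: mem_trace.
by rewrite KL; exact: mem_trace.
Qed.

(** * The Vietoris topology in terms of traces *)

Lemma open_vietoris (X : topologicalType) (i : bool * set X) :
  open i.2 -> open (vietoris_subbase i).
Proof.
move=> oi; exists [set vietoris_subbase i]; last by rewrite bigcup_set1.
move=> _ ->; apply: (@finI_from1 _ _ _ (@vietoris_subbase X)).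
exact: oi.
Qed.

Lemma nbhs_vietorisP (X : topologicalType) (K : hyperspace X)
    (W : set (hyperspace X)) : nbhs K W ->
  exists2 D : {fset bool * set X},
    forall i, i \in D -> open i.2 /\ vietoris_subbase i K &
    \bigcap_(i in [set` D]) vietoris_subbase i `<=` W.
Proof.
rewrite nbhsE => -[B [[E EfinI <-] [A EA AK]] BW].
have [D DO DA] := EfinI _ EA.
exists D => [i iD|L LD].
  split; first by have /set_mem := DO _ iD.
  by have : A K := AK; rewrite -DA; apply.
by apply: BW; exists A; rewrite // -DA.
Qed.

(** Finitely many subbasic conditions fix the trace: lying in the union [V] of the cylinders of its
    words, and meeting each of these cylinders. *)
Lemma nbhs_trace (n : nat) (K : hyperspace Zomega) :
  nbhs K [set L | trace n L = trace n K].
Proof.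
pose U s := [set x : Zomega | prefix n x = s].
have oU s : open (U s).
  by rewrite openE => x <-; exact: nbhs_cylinder.
pose V := \bigcup_(s in [set` trace n K]) U s.
have oV : open V by apply: bigcup_open => s _; exact: oU.
have nV : nbhs K (vietoris_subbase (true, V)).
  apply: open_nbhs_nbhs; split; first exact: (@open_vietoris _ (true, V)).
  by move=> x Kx /=; exists (prefix n x) => //=; exact: mem_trace.
have nU : nbhs K
    (\bigcap_(s in [set` trace n K]) vietoris_subbase (false, U s)).
  apply: filter_bigI => s /traceP[x Kx xs].
  apply: open_nbhs_nbhs; split; last by exists x.
  exact: (@open_vietoris _ (false, U s) (oU s)).
apply: filterS (filterI nV nU) => L [/= LV LU].
apply/fsetP => s; apply/idP/idP => [/traceP[x /LV[r rK xr] <-]|/LU[x [Lx <-]]].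
  by rewrite xr.
exact: mem_trace.
Qed.

Lemma nbhs_traceP (K : hyperspace Zomega) (W : set (hyperspace Zomega)) :
  nbhs K W <-> exists n, [set L | trace n L = trace n K] `<=` W.
Proof.
split=> [|[n /filterS]]; last by apply; exact: nbhs_trace.
move=> /nbhs_vietorisP[D DK DW].
pose F := filter_from setT (fun n => [set L | trace n L = trace n K]).
have FF : Filter F.
  apply: filter_from_filter; first by exists 0%N.
  move=> m n _ _; exists (maxn m n) => // L LK.
  by split; apply: trace_le LK; rewrite ?leq_maxl ?leq_maxr.
suff /(filterS DW)[n _ nW] : F (\bigcap_(i in [set` D]) vietoris_subbase i).
  by exists n.
apply: filter_bigI => -[[] U] /DK[/= oU]; rewrite /vietoris_subbase/=.
  move=> KU.
  (* Containment in [U]: finitely many cylinders inside [U] cover [K]. At their maximal length, each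
     point of [L] shares its prefix with a point of [K], hence lies in one of them. *)
  have /choice[m mU] : forall x, exists n, hset K x -> cylinder n x `<=` U.
    move=> x; have [Kx|nKx] := pselect (hset K x); last by exists 0%N.
    have /nbhs_cylinderP[n xU] : nbhs x U.
      by apply: open_nbhs_nbhs; split => //; exact: KU.
    by exists n.
  have [E EK KE] := compact_cylinder_cover m (hset_compact (K := K)).
  exists (\max_(x <- E) m x)%N => // L LK y Ly.
  have := mem_trace (\max_(x <- E) m x)%N Ly; rewrite LK => /traceP[z Kz zy].
  have [x xE zx] := KE _ Kz; apply: (mU x); first by have /set_mem := EK _ xE.
  rewrite /cylinder/= -zx; apply: esym; apply: prefix_le zy.
  exact: leq_bigmax_seq.
(* Meeting [U]: a single cylinder around a common point decides. *)
move=> [x [Kx Ux]].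
have /nbhs_cylinderP[n xU] : nbhs x U by apply: open_nbhs_nbhs.
exists n => // L LK; have := mem_trace n Kx; rewrite -LK => /traceP[y Ly yx].
by exists y; split=> //; exact: xU.
Qed.

(** * Limits of coherent traces *)

(** The traces form a tree in which every word has an extension, so each word lies on a branch. The
    set [A] of branches therefore has the prescribed traces, and finite branching makes it
    compact. *)
Lemma hyperspace_limit (K_ : nat -> hyperspace Zomega) :
  (forall n, trace n (K_ n.+1) = trace n (K_ n)) ->
  exists K, forall n, trace n K = trace n (K_ n).
Proof.
move=> KS.
have Kle m n : (m <= n)%N -> trace m (K_ n) = trace m (K_ m).
  elim: n => [|n IHn]; first by rewrite leqn0 => /eqP->.
  rewrite leq_eqVlt => /predU1P[->//|]; rewrite ltnS => mn.
  by rewrite -(IHn mn); exact: trace_le mn (KS n).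
pose A := [set x : Zomega | forall n, prefix n x \in trace n (K_ n)].
have extend n s : s \in trace n (K_ n) -> exists2 x, A x & prefix n x = s.
  move=> /traceP[x0 Kx0 <-].
  (* [g] moves to a point of the next level with the same prefix; pairs off the tree get an
     arbitrary value. *)
  have /choice[g gP] : forall jx : nat * Zomega, exists y : Zomega,
      prefix jx.1 jx.2 \in trace jx.1 (K_ jx.1) ->
      prefix jx.1 y = prefix jx.1 jx.2 /\
      prefix jx.1.+1 y \in trace jx.1.+1 (K_ jx.1.+1).
    case=> j x /=.
    have [|nx] := boolP (prefix j x \in trace j (K_ j)); last by exists x.
    rewrite -KS => /traceP[y Ky yx]; exists y => _; split=> //.
    exact: mem_trace.
  (* The limit [x] of the [f j] is a branch of the tree of traces. *)
  pose f j := iteri j (fun j x => g ((n + j)%N, x)) x0.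
  have fK j : prefix (n + j) (f j) \in trace (n + j) (K_ (n + j)%N).
    elim: j => [|j IHj]; first by rewrite addn0; exact: mem_trace.
    by rewrite addnS; have [] := gP (_, _) IHj.
  have fS j : prefix (n + j) (f j.+1) = prefix (n + j) (f j).
    by have [] := gP (_, _) (fK j).
  have fle i j : (i <= j)%N -> prefix (n + i) (f j) = prefix (n + i) (f i).
    elim: j => [|j IHj]; first by rewrite leqn0 => /eqP->.
    rewrite leq_eqVlt => /predU1P[->//|]; rewrite ltnS => ij.
    rewrite -(IHj ij); apply: prefix_le (fS j).
    by rewrite leq_add2l.
  (* [f i.+1] is settled on [n + i.+1] coordinates, which include [i] even if [n] is 0. *)
  pose x : Zomega := fun i => f i.+1 i.
  have xf j : prefix (n + j) x = prefix (n + j) (f j).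
    apply/prefixP => i ilt; rewrite /x; have [ij|ji] := leqP i.+1 j.
      by apply/esym; move/prefixP: (fle _ _ ij); apply; lia.
    by move/prefixP: (fle _ _ (ltnW ji)); apply.
  exists x => [m|]; last by rewrite -[n]addn0 xf.
  rewrite -(Kle m (n + m)%N) ?leq_addl//.
  by apply: (@trace_prefix_le _ (n + m)); rewrite ?leq_addl// xf.
have A0 : A !=set0.
  have [x Kx] := hset_neq0 (K_ 0%N).
  by have [y Ay _] := extend 0%N _ (mem_trace 0 Kx); exists y.
have closedA : closed A.
  move=> x clx n; have [y [Ay yx]] := clx _ (nbhs_cylinder n x).
  by rewrite -yx.
have compactA : compact A.
  (* [A] is closed in a product of finite sets, compact by Tychonoff. *)
  pose B n := [set nth 0 s n | s in [set` trace n.+1 (K_ n.+1)]].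
  have compactB : @compact Zomega [set x : Zomega | forall n, B n (x n)].
    apply: (@tychonoff nat (fun=> discrete_topology int)) => n.
    exact/finite_compact/finite_image/finite_fset.
  apply: (subclosed_compact closedA compactB) => x Ax n.
  by exists (prefix n.+1 x); rewrite ?nth_mkseq//; exact: Ax.
have [K KA] := hyperspace_of A0 compactA.
exists K => n; apply/fsetP => s; apply/idP/idP.
  by move=> /traceP[x + <-]; rewrite KA; exact.
by move=> /extend[x Ax <-]; apply: mem_trace; rewrite KA.
Qed.

(** * Codes of traces and the translation *)

(** The interval radius fed to [separated_centers]. *)
Definition trace_bound (A : {fset seq int}) : nat :=
  \max_(s <- A) \max_(i <- s) `|i|%N.

Lemma coord_le_bound (n : nat) (K : hyperspace Zomega) (x : Zomega) :
  hset K x -> `|x n| <= (trace_bound (trace n.+1 K))%:Z.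
Proof.
move=> Kx; rewrite -abszE lez_nat /trace_bound.
have xi : x n \in prefix n.+1 x by apply: map_f; rewrite mem_iota ltnS leqnn.
apply: leq_trans (leq_bigmax_seq _ (mem_trace n.+1 Kx) _) => //.
exact: (leq_bigmax_seq (F := absz) _ xi).
Qed.

(** The only property of the codes used below. Length [n.+1] is the first at which words contain
    coordinate [n]. *)
Definition separates_traces (c : {fset seq int} -> int) : Prop :=
  forall (n : nat) (K L : hyperspace Zomega) (x y : Zomega),
    hset K x -> hset L y ->
    `|(x n + c (trace n.+1 K)) - (y n + c (trace n.+1 L))| <= 1 ->
    trace n.+1 K = trace n.+1 L.

Lemma separates_traces_exists : exists c, separates_traces c.
Proof.
have [c cP] := separated_centers trace_bound.
exists c => n K L x y Kx Ly; apply: cP; exact: coord_le_bound.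
Qed.

Section translation.
Context (c : {fset seq int} -> int) (cP : separates_traces c).

Definition shift (K : hyperspace Zomega) : Zomega :=
  fun n => c (trace n.+1 K).

Definition shift_graph (p : hyperspace Zomega * Zomega) : Zomega :=
  p.2 + shift p.1.

Lemma shift_trace n K L x y : hset K x -> hset L y ->
  `|(x + shift K) n - (y + shift L) n| <= 1 ->
  trace n.+1 K = trace n.+1 L.
Proof. exact: cP. Qed.

(** Error 0 gives injectivity and disjointness; error 1 absorbs a sign sequence. *)
Lemma shift_near K L x y : hset K x -> hset L y ->
  (forall n, `|(x + shift K) n - (y + shift L) n| <= 1) -> K = L.
Proof.
move=> Kx Ly xy; apply: trace_inj => n; apply: (@trace_le _ n.+1) => //.
exact: shift_trace (xy n).
Qed.

Lemma shift_graph_inj K L x y : hset K x -> hset L y ->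
  x + shift K = y + shift L -> (K, x) = (L, y).
Proof.
move=> Kx Ly xy; have KL : K = L.
  by apply: (shift_near Kx Ly) => n; rewrite xy subrr normr0.
by move: xy; rewrite KL => /addIr ->.
Qed.

Lemma shift_graph_continuous : continuous shift_graph.
Proof.
move=> [K x] U /nbhs_cylinderP[n KxU].
exists ([set L | trace n L = trace n K], cylinder n x).
  by split; [exact: nbhs_trace|exact: nbhs_cylinder].
move=> [L y] [/= LK /prefixP yx]; apply: KxU; apply/prefixP => i ilt.
rewrite /shift_graph/= /GRing.add/= /shift yx//.
by rewrite (trace_le (n := n) _ LK).
Qed.

(** Points of the image agreeing with [y] on longer and longer prefixes come from compact sets with
    coherent traces; the limit [K] of these contains [y - shift K]. *)
Lemma closed_shift_graph :
  closed (shift_graph @` hyperspace_graph (X := Zomega)).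
Proof.
move=> y cly.
have /choice[p pP] : forall n, exists p : hyperspace Zomega * Zomega,
    hset p.1 p.2 /\ prefix n.+1 (shift_graph p) = prefix n.+1 y.
  move=> n; have [_ [[p Hp <-] py]] := cly _ (nbhs_cylinder n.+1 y).
  by exists p.
have py n i : (i <= n)%N -> (p n).2 i + c (trace i.+1 (p n).1) = y i.
  by move=> ilt; have [_ /prefixP] := pP n; apply.
have pS n : trace n (p n.+1).1 = trace n (p n).1.
  apply: (@trace_le _ n.+1) => //.
  apply: (@cP n _ _ (p n.+1).2 (p n).2).
  - exact: (pP _).1.
  - exact: (pP _).1.
  - by rewrite !py// subrr normr0.
have [K Kp] := hyperspace_limit pS.
exists (K, y - shift K); last by rewrite /shift_graph/= subrK.
apply: mem_hset => n /=.
suff -> : prefix n (y - shift K) = prefix n (p n).2.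
  by rewrite Kp; apply: mem_trace; exact: (pP n).1.
apply/prefixP => i ilt; rewrite /GRing.add/= /GRing.opp/= /shift.
rewrite -(py n i (ltnW ilt)) (trace_le ilt (Kp n)).
exact: addrK.
Qed.

(** A prefix of [y] determines the traces, hence the same prefix of the shift; subtracting it leaves
    the prefix of the point. *)
Lemma shift_graph_inverse_continuous
    (g : Zomega -> hyperspace Zomega * Zomega) :
  let F := shift_graph @` hyperspace_graph (X := Zomega) in
  (forall y, F y -> hset (g y).1 (g y).2 /\ shift_graph (g y) = y) ->
  {within F, continuous g}.
Proof.
move=> F gP; apply/subspace_continuousP => y Fy.
move=> W [[A B] [/nbhs_traceP[m mA] /nbhs_cylinderP[n nB]] ABW].
apply/nbhs_cylinderP; exists (maxn m n).+1 => z /prefixP zy Fz.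
have [Hy gy] := gP _ Fy; have [Hz gz] := gP _ Fz.
have tr i : (i <= maxn m n)%N -> trace i.+1 (g z).1 = trace i.+1 (g y).1.
  move=> ile; apply: (shift_trace Hz Hy).
  by rewrite -!/(shift_graph _) gz gy zy// subrr normr0.
apply: ABW; split.
  by apply: mA; apply: (@trace_le _ m.+1) => //; apply/tr/leq_maxl.
apply: nB; apply/prefixP => i ilt.
have ile : (i <= maxn m n)%N by apply: leq_trans (ltnW ilt) (leq_maxr _ _).
have : shift_graph (g z) i = shift_graph (g y) i by rewrite gz gy zy.
rewrite /shift_graph /GRing.add/= /shift tr//.
exact: addIr.
Qed.

End translation.

Theorem theorem3p1 :
  exists t : hyperspace Zomega -> Zomega,
    let H := @hyperspace_graph Zomega in
    let T := fun p : hyperspace Zomega * Zomega => p.2 + t p.1 in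
    let F := T @` H in
    [/\ homeomorphism_between H F T,
        F = \bigcup_(K in [set: hyperspace Zomega]) translate (hset K) (t K),
        trivIset [set: hyperspace Zomega]
          (fun K => translate (hset K) (t K)),
        closed F &
        forall K : hyperspace Zomega,
          minkowski_sum (translate (hset K) (t K)) sign_sequences `&` F
          = translate (hset K) (t K)].
Proof.
have [c cP] := separates_traces_exists.
exists (shift c) => H T F; split.
- have T_inj p q : H p -> H q -> T p = T q -> p = q.
    by case: p q => [K x] [L y]; exact: shift_graph_inj.
  split.
  + split; first by move=> p Hp; exists p.
      by move=> p q /set_mem Hp /set_mem Hq; exact: T_inj.
    by [].
  + exact/continuous_subspaceT/shift_graph_continuous.
  (* [K0] is the singleton of 0, a default value for the inverse off [F]. *)
  + have [K0 _] := hyperspace_of (ex_intro _ 0 erefl) (@compact_set1 Zomega 0).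
    have /choice[g gP] : forall y, exists p, F y -> H p /\ T p = y.
      move=> y; have [[p Hp py]|nFy] := pselect (F y); first by exists p.
      by exists (K0, 0).
    exists g; last exact: shift_graph_inverse_continuous.
    move=> p /set_mem Hp; have [Hg gp] := gP (T p) (imageP _ Hp).
    exact: T_inj.
- apply/seteqP; split=> [_ [[K x] Kx <-]|_ [K _ [x Kx <-]]].
    by exists K => //; exists x.
  by exists (K, x).
- apply/trivIsetP => K L _ _; apply: contra_neqP => /eqP/set0P.
  move=> [_ [[x Kx <-] [y Ly xy]]].
  by have [] := shift_graph_inj cP Kx Ly (esym xy).
- exact: closed_shift_graph.
- move=> K; apply/seteqP; split.
    (* The two representations differ by [e], so by at most 1 in each coordinate, and [shift_near]
       identifies the compact sets. *)
    move=> _ [[_ [x Kx <-] [e se <-]] [[L y] Ly /= yx]].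
    suff KL : L = K by rewrite -yx -KL; exists y.
    apply: (shift_near cP Ly Kx) => n.
    move: yx; rewrite /T/= => ->.
    rewrite -[X in `|X|]/(x n + shift c K n + e n - (x n + shift c K n)).
    by rewrite addrAC subrr add0r; case: (se n) => ->.
  move=> _ [x Kx <-]; split; last by exists (K, x).
  exists (x + shift c K); first by exists x.
  by exists 0; rewrite ?addr0// => n; apply: Or32.
Qed.
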